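(* Let $n,m\geq 1$ and let $(S_1,\dots,S_{n+m})$ be an exchangeable random vector of real scores with almost surely no ties. Define $p_i=\frac{1}{n+1}\big(1+\sum_{j=1}^n\mathbf{1}\{S_j\geq S_{n+i}\}\big)$, $i\in\{1,\dots,m\}$, $\widehat{F}_m(t)=m^{-1}\sum_{i=1}^m\mathbf{1}\{p_i\leq t\}$ and $I_n(t)=\lfloor (n+1)t\rfloor/(n+1)$ for $t\in[0,1]$. Then for all $\lambda>0$, $$\mathbb{P}\Big(\sup_{t\in[0,1]}\big(\widehat{F}_m(t)-I_n(t)\big)>\lambda\Big)\leq B^{\mathrm{DKW}}(\lambda,n,m),$$ where, with $\tau_{n,m}=nm/(n+m)$, $$B^{\mathrm{DKW}}(\lambda,n,m)=\mathbf{1}\{\lambda<1\}\Big[1+\frac{2\sqrt{2\pi}\,\lambda\,\tau_{n,m}}{(n+m)^{1/2}}\Big]e^{-2\tau_{n,m}\lambda^2}.$$ In addition, for every $\delta\in(0,1)$ and every integer $r\geq1$, $B^{\mathrm{DKW}}(\lambda^{\mathrm{DKW}}_{\delta,n,m},n,m)\leq\delta$, where $\lambda^{\mathrm{DKW}}_{\delta,n,m}=\Psi^{(r)}(1)$, $\Psi^{(r)}$ denotes $\Psi$ iterated $r$ times, and $$\Psi(x)=1\wedge\bigg(\frac{\log(1/\delta)+\log\big(1+\sqrt{2\pi}\,\frac{2\tau_{n,m}x}{(n+m)^{1/2}}\big)}{2\tau_{n,m}}\bigg)^{1/2}.$$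
   Context: Exchangeable means the joint distribution is invariant under permutations of the coordinates. *)

(* Defs.v *)
From HB Require Import structures.
From mathcomp Require Import all_boot all_order all_algebra all_fingroup.
From mathcomp Require Import all_classical all_reals all_analysis.
Set Implicit Arguments. Unset Strict Implicit. Unset Printing Implicit Defensive.
Import Order.TTheory GRing.Theory Num.Theory.
Local Open Scope classical_set_scope.
Local Open Scope ring_scope.

Section Defs.
Context {R : realType}.

Definition permute_tuple N (s : 'S_N) (x : N.-tuple R) : N.-tuple R :=
  [tuple tnth x (s i) | i < N].

Definition exchangeable d (T : measurableType d) (P : probability T R)
    N (X : T -> N.-tuple R) : Prop :=
  measurable_fun setT X /\
  forall (s : 'S_N) (A : set (N.-tuple R)), measurable A ->
    P ((fun w => permute_tuple s (X w)) @^-1` A) = P (X @^-1` A).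

Definition as_no_ties d (T : measurableType d) (P : probability T R)
    N (X : T -> N.-tuple R) : Prop :=
  {ae P, forall w, uniq (X w)}.

Variables (n m : nat).

(* scores: S_j (j = 1..n) is coordinate lshift m j, S_{n+i} is rshift n i *)
Definition conf_pvalue (x : (n + m).-tuple R) (i : 'I_m) : R :=
  (1 + (#|[set j : 'I_n | tnth x (rshift n i) <= tnth x (lshift m j)]|)%:R)
    / (n.+1)%:R.

Definition Fhat (x : (n + m).-tuple R) (t : R) : R :=
  (#|[set i : 'I_m | conf_pvalue x i <= t]|)%:R / m%:R.

Definition In_fun (t : R) : R := (Num.floor ((n.+1)%:R * t))%:~R / (n.+1)%:R.

Definition tau : R := (n * m)%:R / (n + m)%:R.

Definition B_DKW (lam : R) : R :=
  (if lam < 1 then 1 else 0) *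
  (1 + 2 * Num.sqrt (2 * pi) * lam * tau / Num.sqrt (n + m)%:R) *
  expR (- (2 * tau * lam ^+ 2)).

Definition Psi (delta x : R) : R :=
  Order.min 1 (Num.sqrt ((ln (1 / delta) +
     ln (1 + Num.sqrt (2 * pi) * (2 * tau * x) / Num.sqrt (n + m)%:R))
     / (2 * tau))).

Definition lambda_DKW (delta : R) (r : nat) : R := iter r (Psi delta) 1.

End Defs.

(* Main.v *)
(** Read the scores from the top: the event forces some upper set of the scores,
    containing [a] calibration and [b] test scores, to satisfy
    [b / m - a / n > lam].  Assume [m <= n] (otherwise read the scores from the
    bottom and exchange the two samples).  By exchangeability the set of ranks of the calibration
    scores is a uniform [n]-subset, so that removing the lowest score repeatedly turns
    [(a, b)] into a Markov chain which leaves [(a, b)] for [(a - 1, b)] with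
    probability [a / (a + b)] and for [(a, b - 1)] otherwise.  For this chain
      [exp (- 2 mu (n m lam - (n b - m a)) / C)],
      [C = ((n + m) a / n + (n + m) b / m + (a + b)) / 3],
    is a supermartingale, at least [1] once the threshold is passed, and its initial
    value is [exp (- 2 tau lam mu)].  If the steps of [C] were infinitesimal one could
    take [mu = lam]: differentiating the supermartingale inequality twice in [lam]
    reduces it to the inequality of arithmetic and geometric means for the three
    terms of [C].  Unit steps are paid for by [mu = lam - 2 / (n + m + 2)], and the
    factor [exp (4 tau lam / (n + m + 2))] lost in this way is at most the
    prefactor of [B_DKW]. *)

Require Import Defs.
From HB Require Import structures.
From mathcomp Require Import all_boot all_order all_algebra all_fingroup.
From mathcomp Require Import all_classical all_reals all_analysis.
From mathcomp Require Import measurable_realfun ring lra.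
Import Order.TTheory GRing.Theory Num.Theory.
Local Open Scope classical_set_scope.
Local Open Scope ring_scope.

(** * Exponential supermartingale *)

Lemma amgm3 (R : realType) (x y z : R) : 0 <= x -> 0 <= y -> 0 <= z ->
  27 * (x * y * z) <= (x + y + z) ^+ 3.
Proof.
move=> x0 y0 z0.
(* The difference of the two sides is three times this expression plus half the next one. *)
have : 0 <= x * (y - z) ^+ 2 + y * (x - z) ^+ 2 + z * (x - y) ^+ 2.
  by rewrite !addr_ge0// mulr_ge0// sqr_ge0.
have : 0 <= (x + y + z) * ((x - y) ^+ 2 + (y - z) ^+ 2 + (x - z) ^+ 2).
  by rewrite mulr_ge0// !addr_ge0// sqr_ge0.
nra.
Qed.

Lemma is_derive_log_ratio (R : realType) (u0 u1 v0 v1 t1 t2 x : R) :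
  0 < u0 + u1 * x -> 0 < v0 - v1 * x ->
  is_derive x 1
    (fun x => ln (u0 + u1 * x) - ln (v0 - v1 * x) - (t1 * x + t2 * (x * x)))
    (u1 / (u0 + u1 * x) + v1 / (v0 - v1 * x) - (t1 + 2 * t2 * x)).
Proof.
move=> u_gt0 v_gt0.
have du : is_derive x 1 (fun x => u0 + u1 * x) u1.
  by apply: is_derive_eq; rewrite /GRing.scale/=; ring.
have dv : is_derive x 1 (fun x => v0 - v1 * x) (- v1).
  by apply: is_derive_eq; rewrite /GRing.scale/=; ring.
have dlu := @is_derive1_comp _ (@ln R) (fun x => u0 + u1 * x) _ _ _
  (is_derive1_ln u_gt0) du.
have dlv := @is_derive1_comp _ (@ln R) (fun x => v0 - v1 * x) _ _ _
  (is_derive1_ln v_gt0) dv.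
have dt : is_derive x 1 (fun x => t1 * x + t2 * (x * x)) (t1 + 2 * t2 * x).
  by apply: is_derive_eq; rewrite /GRing.scale/=; ring.
have dd := is_deriveB (is_deriveB dlu dlv) dt.
by apply: is_derive_eq; rewrite /GRing.scale/=; ring.
Qed.

Section tilting.
Variables (R : realType) (n m : R).
Hypotheses (n_gt0 : 0 < n) (m_gt0 : 0 < m).

(* [wclock a b] is the mean of [(n + m) a / n], [(n + m) b / m] and [a + b], which
   is what makes [wclock_cube] an instance of [amgm3]. *)
Definition wt_major : R := (2 * n + m) / (3 * n).
Definition wt_minor : R := (2 * m + n) / (3 * m).
Definition wclock (a b : R) : R := wt_major * a + wt_minor * b.

Lemma wt_major_gt0 : 0 < wt_major.
Proof. by apply: divr_gt0; move: n_gt0 m_gt0; lra. Qed.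

Lemma wt_minor_gt0 : 0 < wt_minor.
Proof. by apply: divr_gt0; move: n_gt0 m_gt0; lra. Qed.

Lemma wt_sum : wt_major * n + wt_minor * m = n + m.
Proof. by rewrite /wt_major /wt_minor; field; rewrite !gt_eqF. Qed.

Lemma wclock_gt0 a b : 0 <= a -> 0 < b -> 0 < wclock a b.
Proof.
move=> a0 b0; rewrite ltr_wpDl//; first by rewrite mulr_ge0// ltW// wt_major_gt0.
by rewrite mulr_gt0// wt_minor_gt0.
Qed.

Lemma wclock_cube (U V : R) : 0 <= U -> 0 <= V ->
  U * V * (U + V) * (n + m) ^+ 2 <= n * m * (wclock U V) ^+ 3.
Proof.
move=> U0 V0.
have N0 : 0 <= n + m by rewrite addr_ge0 ?ltW.
have Un0 : 0 <= (n + m) * (U / n) by rewrite mulr_ge0// divr_ge0// ltW.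
have Vm0 : 0 <= (n + m) * (V / m) by rewrite mulr_ge0// divr_ge0// ltW.
have H := amgm3 _ _ _ _ Un0 Vm0 (addr_ge0 U0 V0).
have -> : wclock U V = ((n + m) * (U / n) + (n + m) * (V / m) + (U + V)) / 3.
  by rewrite /wclock /wt_major /wt_minor; field; rewrite !gt_eqF.
have -> : U * V * (U + V) * (n + m) ^+ 2 =
    n * m / 27 * (27 * ((n + m) * (U / n) * ((n + m) * (V / m)) * (U + V))).
  by field; rewrite !gt_eqF.
rewrite expr_div_n.
have -> : forall z : R, n * m * (z / 3 ^+ 3) = n * m / 27 * z by move=> z; field.
by rewrite ler_wpM2l// divr_ge0// mulr_ge0// ltW.
Qed.

Let N := n + m.

(** This is the sign of the derivative in [lam] needed by [tilt_mgf_le1]. In logarithms it reads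
    [f 0 <= f lam]. The derivative of [f] is nonnegative by [wclock_cube], because [wclock] keeps
    the value [N * C] along the line followed by the two arguments of [ln]. *)
Lemma tilt_log_ratio (a b lam : R) : 0 < a -> 0 < b -> 0 <= lam ->
  a * (b * N - 2 * wt_major * (n * m) * lam) *
  expR (2 * lam * ((a + b) * N + (wt_minor - wt_major) * (n * m) * lam)
        / wclock a b ^+ 2) <= b * (a * N + 2 * wt_minor * (n * m) * lam).
Proof.
move=> a0 b0 lam0; set C := wclock a b.
set U := a * N + 2 * wt_minor * (n * m) * lam.
set V := b * N - 2 * wt_major * (n * m) * lam.
have be0 := wt_minor_gt0; have al0 := wt_major_gt0.
have nm0 : 0 < n * m by rewrite mulr_gt0.
set u1 := 2 * wt_minor * (n * m) in U *; set v1 := 2 * wt_major * (n * m) in V *.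
have u10 : 0 < u1 by rewrite pmulr_lgt0// pmulr_rgt0.
have v10 : 0 < v1 by rewrite pmulr_lgt0// pmulr_rgt0.
have [V_le0|V_gt0] := leP V 0.
  rewrite (@le_trans _ _ 0)//.
    by rewrite mulr_le0_ge0 ?expR_ge0// mulr_ge0_le0// ltW.
  rewrite mulr_ge0 ?(ltW b0)// /U addr_ge0//.
    by rewrite mulr_ge0 ?addr_ge0 ?ltW.
  by rewrite mulr_ge0// ltW.
have C0 : 0 < C by rewrite wclock_gt0// ltW.
have N0 : 0 < N by rewrite addr_gt0.
pose t1 := 2 * (a + b) * N / C ^+ 2.
pose t2 := 2 * (wt_minor - wt_major) * (n * m) / C ^+ 2.
pose f x := ln (a * N + u1 * x) - ln (b * N - v1 * x) - (t1 * x + t2 * (x * x)).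
have Upos x : 0 <= x -> 0 < a * N + u1 * x.
  by move=> x0; rewrite ltr_pwDl ?mulr_gt0// mulr_ge0// ltW.
have Vpos x : x <= lam -> 0 < b * N - v1 * x.
  move=> xl; rewrite (lt_le_trans V_gt0)// lerD2l lerN2 ler_wpM2l//.
  exact: ltW.
have df x : 0 <= x <= lam -> is_derive x 1 f
    (u1 / (a * N + u1 * x) + v1 / (b * N - v1 * x) - (t1 + 2 * t2 * x)).
  by case/andP=> x0 xl; apply: is_derive_log_ratio; [exact: Upos | exact: Vpos].
have f_mono : f 0 <= f lam.
  apply: (@ger0_derive1_ndecr R f 0 lam) => //.
  - move=> x; rewrite in_itv/= => /andP[x0 xl].
    by have /df [] : 0 <= x <= lam by rewrite !ltW.
  - move=> x; rewrite in_itv/= => /andP[x0 xl].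
    have xx : 0 <= x <= lam by rewrite !ltW.
    rewrite derive1E (@derive_val _ _ _ _ _ _ _ (df x xx)).
    have Ux := Upos x (ltW x0); have Vx := Vpos x (ltW xl).
    have := wclock_cube _ _ (ltW Ux) (ltW Vx).
    have -> : wclock (a * N + u1 * x) (b * N - v1 * x) = N * C.
      by rewrite /wclock /u1 /v1 /C /wclock; ring.
    move=> H.
    rewrite subr_ge0.
    have -> : t1 + 2 * t2 * x =
        2 * ((a * N + u1 * x) + (b * N - v1 * x)) / C ^+ 2.
      by rewrite /t1 /t2 /u1 /v1; field; rewrite gt_eqF.
    have -> : u1 / (a * N + u1 * x) + v1 / (b * N - v1 * x) =
        2 * (n * m) * (N * C) / ((a * N + u1 * x) * (b * N - v1 * x)).
      by rewrite /C /wclock /u1 /v1; field; rewrite !gt_eqF.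
    rewrite ler_pdivrMr ?exprn_gt0// [leRHS]mulrAC ler_pdivlMr ?mulr_gt0//.
    rewrite -(@ler_pM2r _ (N ^+ 2)) ?exprn_gt0//.
    move: H; rewrite -/N; set UU := _ + u1 * x; set VV := _ - v1 * x => H.
    have -> : 2 * (n * m) * (N * C) * C ^+ 2 * N ^+ 2 = 2 * (n * m * (N * C) ^+ 3).
      by ring.
    have -> : 2 * (UU + VV) * (UU * VV) * N ^+ 2 = 2 * (UU * VV * (UU + VV) * N ^+ 2).
      by ring.
    by rewrite ler_wpM2l.
  - apply: derivable_within_continuous => x; rewrite in_itv/= => xx.
    by have [] := df x xx.
have aN0 : 0 < a * N by rewrite mulr_gt0.
have bN0 : 0 < b * N by rewrite mulr_gt0.
have U0 := Upos lam lam0; have V0 := Vpos lam (lexx _).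
have : ln (a * N * V) + (t1 * lam + t2 * (lam * lam)) <= ln (b * N * U).
  move: f_mono; rewrite /f !mulr0 addr0 subr0 addr0 subr0.
  rewrite !lnM ?posrE// -/u1 -/v1 /U /V; lra.
rewrite -[X in is_true X -> _]ler_expR expRD !lnK ?posrE ?mulr_gt0//.
have -> : t1 * lam + t2 * (lam * lam) =
    2 * lam * ((a + b) * N + (wt_minor - wt_major) * (n * m) * lam) / C ^+ 2.
  by rewrite /t1 /t2; field; rewrite gt_eqF.
set e := expR _; move=> H.
rewrite -(@ler_pM2l _ N)//; lra.
Qed.

(** One step of the chain with [mu = lam], where the product of the clocks before and after the step
    is replaced by [C ^+ 2], as for infinitesimal steps. Equality holds at [lam = 0], and
    [tilt_log_ratio] makes the left side nonincreasing in [lam]. *)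
Lemma tilt_mgf_le1 (a b lam : R) : 0 < a -> 0 < b -> 0 <= lam ->
  a * expR (2 * lam * (b * N - wt_major * (n * m) * lam) / wclock a b ^+ 2) +
  b * expR (- (2 * lam * (a * N + wt_minor * (n * m) * lam) / wclock a b ^+ 2))
  <= a + b.
Proof.
move=> a0 b0 lam0; set C := wclock a b.
have C0 : 0 < C by rewrite wclock_gt0// ltW.
pose x1 := 2 * b * N / C ^+ 2; pose x2 := 2 * wt_major * (n * m) / C ^+ 2.
pose y1 := 2 * a * N / C ^+ 2; pose y2 := 2 * wt_minor * (n * m) / C ^+ 2.
pose p x := x1 * x - x2 * (x * x); pose q x := - (y1 * x + y2 * (x * x)).
pose f x := a * expR (p x) + b * expR (q x).
have dp (x : R) : is_derive x 1 p (x1 - 2 * x2 * x).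
  by apply: is_derive_eq; rewrite /GRing.scale/=; ring.
have dq (x : R) : is_derive x 1 q (- (y1 + 2 * y2 * x)).
  by apply: is_derive_eq; rewrite /GRing.scale/=; ring.
have df (x : R) : is_derive x 1 f (a * ((x1 - 2 * x2 * x) * expR (p x)) +
                             b * (- (y1 + 2 * y2 * x) * expR (q x))).
  have dep := @is_derive1_comp _ (@expR R) p _ _ _ (is_derive_expR _) (dp x).
  have deq := @is_derive1_comp _ (@expR R) q _ _ _ (is_derive_expR _) (dq x).
  have dd := is_deriveD (is_deriveZ a dep) (is_deriveZ b deq).
  by apply: is_derive_eq; rewrite /GRing.scale/=; ring.
have f_dec : f lam <= f 0.
  apply: (@ler0_derive1_nincr R f 0 lam) => //.
  - move=> x; rewrite in_itv/= => /andP[x0 _].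
    rewrite derive1E (@derive_val _ _ _ _ _ _ _ (df x)).
    have H := tilt_log_ratio a b x a0 b0 (ltW x0); rewrite -/C in H.
    have E : expR (p x) = expR (q x) * expR (2 * x *
       ((a + b) * N + (wt_minor - wt_major) * (n * m) * x) / C ^+ 2).
      rewrite -expRD; congr expR; rewrite /p /q /x1 /x2 /y1 /y2.
      by field; rewrite gt_eqF.
    rewrite E; move: H; set e := expR (2 * x * _ / _); set g := expR _ => H.
    have -> : a * ((x1 - 2 * x2 * x) * (g * e)) + b * (- (y1 + 2 * y2 * x) * g) =
      2 * g / C ^+ 2 * (a * (b * N - 2 * wt_major * (n * m) * x) * e -
                        b * (a * N + 2 * wt_minor * (n * m) * x)).
      by rewrite /x1 /x2 /y1 /y2; field; rewrite gt_eqF.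
    rewrite mulr_ge0_le0 ?subr_le0// divr_ge0 ?exprn_ge0 ?(ltW C0)//.
    by rewrite mulr_ge0// expR_ge0.
  - by apply: derivable_within_continuous => x _; have [] := df x.
have -> : a + b = f 0 by rewrite /f /p /q !mulr0 subrr addr0 oppr0 expR0 !mulr1.
rewrite [leLHS](_ : _ = f lam)// /f; congr (a * expR _ + b * expR _).
  by rewrite /p /x1 /x2; field; rewrite gt_eqF.
by rewrite /q /y1 /y2; field; rewrite gt_eqF.
Qed.

Definition tilt (lam mu a b : R) : R :=
  expR (- (2 * mu * (n * m * lam - (n * b - m * a)) / wclock a b)).

Lemma tilt_start (lam mu : R) :
  tilt lam mu n m = expR (- (2 * (n * m / N) * lam * mu)).
Proof.
have N0 : 0 < N by rewrite addr_gt0.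
rewrite /tilt /wclock wt_sum -/N (mulrC n m) subrr subr0.
by congr (expR (- _)); field; rewrite gt_eqF.
Qed.

Lemma tilt_ge1 (lam mu a b : R) : 0 <= mu -> 0 <= wclock a b ->
  n * m * lam <= n * b - m * a -> 1 <= tilt lam mu a b.
Proof.
move=> mu0 C0 hit; rewrite -expR0 ler_expR oppr_ge0.
by rewrite mulr_le0_ge0 ?invr_ge0// mulr_ge0_le0 ?mulr_ge0// subr_le0.
Qed.

Hypothesis le_mn : m <= n.

Lemma wt_le : wt_major <= wt_minor.
Proof.
rewrite /wt_major /wt_minor ler_pdivrMr ?mulr_gt0// mulrAC ler_pdivlMr ?mulr_gt0//.
have : 0 <= (n - m) * (n + m) by rewrite mulr_ge0 ?subr_ge0// addr_ge0// ltW.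
lra.
Qed.

(** Measures how far [mu] must stay below [lam]. The clock is smallest at [a = 1], [b = m * lam];
    there the claim reduces to [wt_major * N <= 2 * wt_minor * m], that is, to
    [m * (n - m) >= 0]. *)
Lemma tilt_shrink (lam a b : R) : 0 <= lam -> lam <= 1 -> 1 <= a -> m * lam <= b ->
  lam * wt_major / wclock a b <= 2 / (N + 2).
Proof.
move=> lam0 lam1 a1 blam.
have al0 := wt_major_gt0; have be0 := wt_minor_gt0.
have N2 : 0 < N + 2 by rewrite addr_gt0// addr_gt0.
have C1 : wt_major + wt_minor * (m * lam) <= wclock a b.
  by rewrite lerD ?ler_wpM2l ?ler_peMr ?(ltW al0) ?(ltW be0).
have C0 : 0 < wclock a b.
  apply: lt_le_trans C1; rewrite ltr_pwDl// mulr_ge0 ?(ltW be0)//.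
  by rewrite mulr_ge0// ltW.
rewrite ler_pdivrMr// mulrAC ler_pdivlMr//.
apply: (@le_trans _ _ (2 * (lam * wt_major + wt_minor * (m * lam)))); last first.
  rewrite ler_pM2l//; apply: le_trans C1; rewrite lerD2r.
  by rewrite ler_piMl// ltW.
have -> : lam * wt_major * (N + 2) =
    lam * (wt_major * N) + 2 * lam * wt_major by ring.
have -> : 2 * (lam * wt_major + wt_minor * (m * lam)) =
    lam * (2 * wt_minor * m) + 2 * lam * wt_major by ring.
rewrite lerD2r ler_wpM2l//.
have -> : 2 * wt_minor * m = 2 * (2 * m + n) / 3.
  by rewrite /wt_minor; field; rewrite gt_eqF.
rewrite /wt_major mulrAC ler_pdivrMr ?mulr_gt0//.
have -> : 2 * (2 * m + n) / 3 * (3 * n) = 2 * (2 * m + n) * n by field.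
have : 0 <= m * (n - m) by rewrite mulr_ge0 ?subr_ge0// ltW.
rewrite /N; lra.
Qed.

(** The chord of the convex function [expR] from 0 to [x], obtained from the tangent at [k * x]. *)
Lemma expR_scale_le (k x : R) : 0 <= k -> k <= 1 ->
  expR (k * x) <= 1 - k + k * expR x.
Proof.
move=> k0 k1.
have E : expR x = expR (k * x) * expR (x - k * x) by rewrite -expRD; congr expR; ring.
have F : 1 = expR (k * x) * expR (- (k * x)) by rewrite -expRD subrr expR0.
have H1 := expR_ge1Dx (x - k * x); have H2 := expR_ge1Dx (- (k * x)).
have e0 := expR_gt0 (k * x).
rewrite E.
have -> : 1 - k = (1 - k) * (expR (k * x) * expR (- (k * x))) by rewrite -F mulr1.
rewrite [leRHS](_ : _ = expR (k * x) *
    ((1 - k) * expR (- (k * x)) + k * expR (x - k * x))); last by ring.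
rewrite ler_peMr ?(ltW e0)//.
have : (1 - k) * (1 + - (k * x)) + k * (1 + (x - k * x)) <=
       (1 - k) * expR (- (k * x)) + k * expR (x - k * x).
  by rewrite lerD// ler_wpM2l// subr_ge0.
by apply: le_trans; lra.
Qed.

(* The steps of size wt_major, wt_minor turn the square of the clock into
   C (C - wt_major) and C (C - wt_minor); the loss is absorbed by shrinking
   lam to mu, because the exponential is convex. *)
Lemma tilt_supermartingale (lam mu a b : R) : 0 < lam -> lam <= 1 ->
  0 <= mu -> mu = 0 \/ mu <= lam - 2 / (N + 2) ->
  1 <= a -> 1 <= b -> m * lam <= b ->
  a * tilt lam mu (a - 1) b + b * tilt lam mu a (b - 1)
    <= (a + b) * tilt lam mu a b.
Proof.
move=> lam0 lam1 mu0 mu_le a1 b1 blam.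
have [->|mu_neq0] := eqVneq mu 0.
  by rewrite /tilt !(mulr0, mul0r) oppr0 expR0 !mulr1.
have {mu_le} mu_le : mu <= lam - 2 / (N + 2).
  by case: mu_le => // e; rewrite e eqxx in mu_neq0.
have al0 := wt_major_gt0; have be0 := wt_minor_gt0.
have a0 : 0 < a by rewrite (lt_le_trans _ a1).
have b0 : 0 < b by rewrite (lt_le_trans _ b1).
set C := wclock a b.
have C0 : 0 < C by rewrite wclock_gt0// ltW.
have Cal : wclock (a - 1) b = C - wt_major by rewrite /C /wclock; ring.
have Cbe : wclock a (b - 1) = C - wt_minor by rewrite /C /wclock; ring.
have Cal0 : 0 < C - wt_major by rewrite -Cal wclock_gt0// subr_ge0.
have Cbe0 : 0 < C - wt_minor.
  rewrite -Cbe /wclock ltr_pwDl//; first by rewrite mulr_gt0.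
  by rewrite mulr_ge0 ?(ltW be0)// subr_ge0.
pose X := 2 * lam * (b * N - wt_major * (n * m) * lam) / C ^+ 2.
pose Y := 2 * lam * (a * N + wt_minor * (n * m) * lam) / C ^+ 2.
(* With this [k] the move to [a - 1] multiplies the tilt by exactly [expR (k * X)], and
   [tilt_shrink] gives [k <= 1]. *)
pose k := mu / (lam * ((C - wt_major) / C)).
have r0 : 0 < lam * ((C - wt_major) / C) by rewrite mulr_gt0// divr_gt0.
have k0 : 0 <= k by rewrite divr_ge0// ltW.
have k1 : k <= 1.
  rewrite ler_pdivrMr// mul1r (le_trans mu_le)//.
  have -> : lam * ((C - wt_major) / C) = lam - lam * wt_major / C.
    by field; rewrite gt_eqF.
  by rewrite lerD2l lerN2 tilt_shrink// ltW.
have bN : b * N = m * C + wt_major * (n * b - m * a).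
  by rewrite /N -wt_sum /C /wclock; ring.
have aN : a * N = n * C - wt_minor * (n * b - m * a).
  by rewrite /N -wt_sum /C /wclock; ring.
have EX : tilt lam mu (a - 1) b = tilt lam mu a b * expR (k * X).
  rewrite /tilt -expRD Cal -/C; congr expR; rewrite /k /X bN.
  by field; rewrite !gt_eqF.
(* The exact denominator is [C - wt_minor]; by [wt_le] it is at most [C - wt_major], so the same [k]
   serves both moves. *)
have EY : tilt lam mu a (b - 1) <= tilt lam mu a b * expR (- (k * Y)).
  have -> : tilt lam mu a (b - 1) = tilt lam mu a b *
      expR (- (2 * mu * (a * N + wt_minor * (n * m) * lam) / C / (C - wt_minor))).
    rewrite /tilt -expRD Cbe -/C; congr expR; rewrite aN.
    by field; rewrite !gt_eqF.
  have -> : k * Y = 2 * mu * (a * N + wt_minor * (n * m) * lam) / C / (C - wt_major).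
    by rewrite /k /Y; field; rewrite !gt_eqF.
  rewrite ler_wpM2l ?expR_ge0// ler_expR lerN2 ler_wpM2l//; last first.
    by rewrite lef_pV2 ?posrE// lerD2l lerN2 wt_le.
  rewrite divr_ge0 ?(ltW C0)// mulr_ge0 ?mulr_ge0// addr_ge0//.
    by rewrite mulr_ge0 ?addr_ge0 ?ltW.
  by rewrite mulr_ge0 ?(ltW lam0)// mulr_ge0 ?(ltW be0)// mulr_ge0 ?ltW.
apply: (@le_trans _ _ (tilt lam mu a b *
    (a * (1 - k + k * expR X) + b * (1 - k + k * expR (- Y))))).
  rewrite EX mulrDr lerD//.
    by rewrite mulrCA ler_wpM2l ?expR_ge0// ler_wpM2l ?(ltW a0)// expR_scale_le.
  apply: le_trans (ler_wpM2l (ltW b0) EY) _.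
  rewrite mulrCA ler_wpM2l ?expR_ge0// ler_wpM2l ?(ltW b0)//.
  by rewrite -mulrN expR_scale_le.
rewrite [leRHS]mulrC ler_wpM2l ?expR_ge0//.
have H := tilt_mgf_le1 a b lam a0 b0 (ltW lam0); rewrite -/C -/X -/Y in H.
have -> : a * (1 - k + k * expR X) + b * (1 - k + k * expR (- Y)) =
  (1 - k) * (a + b) + k * (a * expR X + b * expR (- Y)) by ring.
apply: (@le_trans _ _ ((1 - k) * (a + b) + k * (a + b))); last by lra.
by rewrite lerD2l ler_wpM2l.
Qed.

End tilting.

(** * Counting words and rank sets *)

Fixpoint bitwords (k : nat) : seq (seq bool) :=
  if k is k'.+1 then map (cons true) (bitwords k') ++ map (cons false) (bitwords k')
  else [:: [::]].

Lemma mem_bitwords (w : seq bool) : w \in bitwords (size w).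
Proof.
elim: w => [|x w IH]; first by rewrite inE.
by rewrite mem_cat; case: x; rewrite map_f// orbT.
Qed.

Lemma size_bitwords k w : w \in bitwords k -> size w = k.
Proof.
elim: k w => [|k IH] w /=; first by rewrite inE => /eqP ->.
by rewrite mem_cat => /orP[] /mapP[u /IH <- ->].
Qed.

Lemma count_bitwordsS (P : pred (seq bool)) k :
  count P (bitwords k.+1) =
  (count (fun w => P (true :: w)) (bitwords k) +
   count (fun w => P (false :: w)) (bitwords k))%N.
Proof. by rewrite /= count_cat !count_map. Qed.

Lemma count_bitwords k b :
  count (fun w => count id w == b) (bitwords k) = 'C(k, b).
Proof.
elim: k b => [|k IH] b; first by case: b.
rewrite count_bitwordsS; case: b => [|b].
  rewrite (@eq_count _ _ pred0)// count_pred0 add0n.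
  by rewrite (eq_count (a2 := fun w => count id w == 0%N)) ?IH ?bin0.
rewrite (eq_count (a2 := fun w => count id w == b))//.
rewrite [X in (_ + X)%N](eq_count (a2 := fun w => count id w == b.+1))//.
by rewrite !IH binS addnC.
Qed.

Section overshoot.
Variables (R : realType) (n m : nat) (lam : R).
Hypotheses (m_gt0 : (0 < m)%N) (le_mn : (m <= n)%N).
Hypotheses (lam_gt0 : 0 < lam) (lam_le1 : lam <= 1).

(** The condition [b / m - a / n > lam] with denominators cleared. *)
Definition ahead (a b : nat) : bool :=
  n%:R * m%:R * lam < n%:R * b%:R - m%:R * a%:R.

(* In a word, [true] stands for the letter whose excess is measured. *)
Fixpoint overshoots (w : seq bool) : bool :=
  ahead (count negb w) (count id w) || (if w is _ :: w' then overshoots w' else false).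

Lemma overshoots_drop w i :
  ahead (count negb (drop i w)) (count id (drop i w)) -> overshoots w.
Proof.
elim: w i => [|x w IH] i; first by case: i => [|i] /= ->.
by case: i => [|i] /= h; apply/orP; [left | right; exact: IH h].
Qed.

Let n_gt0 : (0 < n)%N. Proof. exact: leq_trans le_mn. Qed.
Let nR_gt0 : 0 < n%:R :> R. Proof. by rewrite ltr0n. Qed.
Let mR_gt0 : 0 < m%:R :> R. Proof. by rewrite ltr0n. Qed.

Lemma ahead_count a b : ahead a b -> m%:R * lam < b%:R.
Proof.
rewrite /ahead -mulrA => h; rewrite -(ltr_pM2l nR_gt0).
by apply: lt_le_trans h _; rewrite gerBl mulr_ge0.
Qed.

Lemma overshoots_count w : overshoots w -> m%:R * lam < (count id w)%:R.
Proof.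
elim: w => [|x w IH] /=; first by rewrite orbF => /ahead_count.
case/orP => [/ahead_count//|/IH] /lt_le_trans; apply.
by rewrite ler_nat leq_addl.
Qed.

(** Optional stopping by induction on the length: deleting the first letter of a uniform word with
    [b] letters [true] is one step of the chain. Once [ahead] holds the tilt is at least 1; before
    that, the supermartingale inequality applies. *)
Lemma count_overshoots (mu : R) k b : (b <= k)%N ->
  0 <= mu -> mu = 0 \/ mu <= lam - 2 / (n%:R + m%:R + 2) ->
  (count (fun w => (count id w == b) && overshoots w) (bitwords k))%:R <=
  'C(k, b)%:R * tilt R n%:R m%:R lam mu (k - b)%:R b%:R.
Proof.
move=> le_bk mu0 mu_le; elim: k b le_bk => [|k IH] b le_bk.
  rewrite (_ : count _ _ = 0%N) ?mulr_ge0 ?expR_ge0//.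
  apply/eqP; rewrite -leqn0 leqNgt -has_count; apply/hasPn => w.
  rewrite inE => /eqP ->; rewrite /= orbF negb_and; apply/orP; right.
  by apply/negP => /ahead_count; rewrite ltNge mulr_ge0 ?ltW.
(* Below this level no suffix can be ahead, which settles the range outside the hypothesis
   [m * lam <= b] of [tilt_supermartingale]. *)
have [small|large] := leP (b%:R) (m%:R * lam).
  rewrite (_ : count _ _ = 0%N) ?mulr_ge0 ?expR_ge0//.
  apply/eqP; rewrite -leqn0 leqNgt -has_count; apply/hasPn => w _.
  by apply/negP => /andP[/eqP cw /overshoots_count]; rewrite cw ltNge small.
have b_gt0 : (0 < b)%N by rewrite -(ltr0n R) (le_lt_trans _ large)// mulr_ge0 ?ltW.
have [hit|nhit] := boolP (ahead (k.+1 - b) b).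
  apply: (@le_trans _ _ 'C(k.+1, b)%:R).
    rewrite ler_nat -count_bitwords; apply: sub_count => w /=.
    by case/andP.
  rewrite ler_peMr// tilt_ge1// ?(ltW hit)//.
  by rewrite ltW// wclock_gt0// ltr0n.
case: b le_bk large b_gt0 nhit => // b le_bk large _ nhit.
(* Without any letter [false], [large] would already put the state ahead; hence [a >= 1]. *)
have {le_bk} lt_bk : (b < k)%N.
  rewrite ltn_neqAle -ltnS le_bk andbT; apply: contra nhit => /eqP <-.
  by rewrite /ahead subnn mulr0 subr0 -mulrA ltr_pM2l.
rewrite count_bitwordsS.
rewrite (@eq_in_count _ _ (fun w => (count id w == b) && overshoots w)); last first.
  move=> w /size_bitwords sw /=; rewrite add1n add0n eqSS.
  case: eqP => //= cw; rewrite (_ : ahead _ _ = false)//.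
  apply: contraNF nhit; rewrite cw.
  rewrite (_ : count negb w = (k.+1 - b.+1)%N)// -sw -(count_predC id) cw.
  by rewrite subSS addKn.
rewrite [X in (_ + X)%N](@eq_in_count _ _
    (fun w => (count id w == b.+1) && overshoots w)); last first.
  move=> w /size_bitwords sw /=; rewrite add1n add0n.
  case: eqP => //= cw; rewrite (_ : ahead _ _ = false)//.
  apply: contraNF nhit; rewrite cw.
  rewrite (_ : (count negb w).+1 = (k.+1 - b.+1)%N)// -sw -(count_predC id) cw.
  by rewrite -addnS addKn.
rewrite natrD.
apply: (le_trans (lerD (IH b (ltnW lt_bk)) (IH b.+1 lt_bk))).
have k1 : 0 < k.+1%:R :> R by rewrite ltr0n.
(* Multiplication by the length turns both binomials into ['C(k.+1, b.+1)], weighted by the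
   transition counts [b.+1] and [k - b]. *)
rewrite -(ler_pM2l k1) mulrDr !mulrA -!natrM.
have -> : (k.+1 * 'C(k, b))%N = (b.+1 * 'C(k.+1, b.+1))%N by rewrite mul_bin_diag.
have -> : (k.+1 * 'C(k, b.+1))%N = ((k - b) * 'C(k.+1, b.+1))%N.
  by rewrite (mul_bin_down k.+1) subSS.
rewrite subSS.
have a1 : 1 <= (k - b)%:R :> R by rewrite ler1n subn_gt0.
have b1 : 1 <= b.+1%:R :> R by rewrite ler1n.
have := @tilt_supermartingale R n%:R m%:R nR_gt0 mR_gt0 _ lam mu (k - b)%:R b.+1%:R.
rewrite ler_nat => /(_ le_mn lam_gt0 lam_le1 mu0 mu_le a1 b1 (ltW large)).
have -> : (k - b)%:R + b.+1%:R = k.+1%:R :> R.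
  by rewrite -natrD addnS subnK// ltnW.
have -> : (k - b)%:R - 1 = (k - b.+1)%:R :> R by rewrite -(subnSK lt_bk) -natr1 addrK.
have -> : b.+1%:R - 1 = b%:R :> R by rewrite -natr1 addrK.
move=> H.
rewrite !natrM -!mulrA addrC.
have H' := ler_wpM2l (ler0n R 'C(k.+1, b.+1)) H.
lra.
Qed.

End overshoot.

Lemma filter_sorted_take (T : eqType) (leT : rel T) (p : pred T) (s : seq T) :
  transitive leT -> (forall u v, leT u v -> p v -> p u) -> sorted leT s ->
  [seq u <- s | p u] = take (count p s) s.
Proof.
move=> leT_tr p_dn; elim: s => //= u s IH us.
have [pu|npu] := boolP (p u); first by rewrite add1n /= IH// (path_sorted us).
have /(order_path_min leT_tr)/allP umin := us.
have np v : v \in s -> ~~ p v.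
  by move=> /umin uv; apply: contra npu; exact: p_dn uv.
rewrite add0n (_ : count p s = 0%N) ?take0; last first.
  by apply/eqP; rewrite -leqn0 leqNgt -has_count; apply/hasPn.
by apply/eqP; rewrite -(negbK (_ == _)) -has_filter; apply/hasPn.
Qed.

(** * Calibration index sets and their rank words *)

Section sets.
Variables (R : realType) (n m : nat) (x : 'I_(n + m) -> R).
Notation N := (n + m)%N.

Definition upper_set (z : 'I_N) : {set 'I_N} := finset (fun k => x z <= x k).

(** [A] stands for the indices that carry calibration scores and [~: A] for those that carry test
    scores. *)
Definition set_overshoots (lam : R) (A : {set 'I_N}) : bool :=
  [exists z, n%:R * m%:R * lam <
     n%:R * (#|~: A :&: upper_set z|)%:R - m%:R * (#|A :&: upper_set z|)%:R].

Let geT : rel 'I_N := fun i j => x j <= x i.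
Let ranking := sort geT (enum 'I_N).
Definition rank_word (A : {set 'I_N}) : seq bool := [seq k \in A | k <- ranking].

Let mem_ranking k : k \in ranking.
Proof. by rewrite mem_sort mem_enum. Qed.

Let count_ranking (p : pred 'I_N) : count p ranking = #|p|.
Proof.
have /seq.permP -> : perm_eq ranking (enum 'I_N) by rewrite perm_sort.
by rewrite cardE /(enum p) size_filter enumT.
Qed.

Let size_ranking : size ranking = N.
Proof. by rewrite size_sort size_enum_ord. Qed.

Lemma size_rank_word A : size (rank_word A) = N.
Proof. by rewrite size_map. Qed.

Lemma count_rank_word A : count id (rank_word A) = #|A|.
Proof. by rewrite count_map; exact: count_ranking. Qed.

Lemma rank_word_inj : injective rank_word.
Proof.
move=> A B eqAB; apply/setP => k.
have : nth false (rank_word A) (index k ranking) =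
    nth false (rank_word B) (index k ranking).
  by rewrite eqAB.
by rewrite !(nth_map k) ?index_mem ?mem_ranking// !nth_index ?mem_ranking.
Qed.

(** The ranking starts with the highest scores, so an upper set is a prefix of it; its length
    depends on [z] alone and serves every [A]. *)
Lemma take_rank_word (z : 'I_N) : exists2 i : nat, (i <= N)%N & forall A,
  count id (take i (rank_word A)) = #|A :&: upper_set z| /\
  count negb (take i (rank_word A)) = #|~: A :&: upper_set z|.
Proof.
exists (count (fun k => x z <= x k) ranking) => [|A].
  by rewrite -[leqRHS]size_ranking count_size.
rewrite -map_take -(@filter_sorted_take _ geT).
- rewrite !count_map !count_filter !count_ranking; split; apply: eq_card => k.
    by rewrite !inE.
  by rewrite !inE.
- by move=> j i k ij jk; exact: le_trans jk ij.
- by move=> i j /[swap]; exact: le_trans.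
- by apply: sort_sorted => i j; exact: le_total.
Qed.

Lemma card_set_words (P : pred {set 'I_N}) (Q : pred (seq bool))
    (f : {set 'I_N} -> seq bool) : injective f -> (forall A, size (f A) = N) ->
  (forall A, P A -> Q (f A)) -> (#|[pred A | P A]| <= count Q (bitwords N))%N.
Proof.
move=> f_inj f_size PQ; rewrite cardE -(size_map f) -size_filter.
apply: uniq_leq_size; first by rewrite map_inj_uniq// enum_uniq.
move=> w /mapP[A]; rewrite mem_enum inE => PA ->; rewrite mem_filter PQ//.
by rewrite -(f_size A) mem_bitwords.
Qed.

Hypotheses (n_gt0 : (0 < n)%N) (m_gt0 : (0 < m)%N).

(* The tilting argument needs the overshooting letter to be the rarer one:
   scores are read from the top when m <= n, and otherwise from the bottom,
   where the remaining calibration scores are in excess. *)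
Lemma card_set_overshoots (lam mu : R) : 0 < lam -> lam <= 1 ->
  0 <= mu -> mu = 0 \/ mu <= lam - 2 / ((n + m)%:R + 2) ->
  (#|[pred A : {set 'I_N} | (#|A| == n) && set_overshoots lam A]|)%:R <=
  'C(n + m, n)%:R * expR (- (2 * ((n * m)%:R / (n + m)%:R) * lam * mu)).
Proof.
move=> lam0 lam1 mu0 mu_le.
have nR : 0 < n%:R :> R by rewrite ltr0n.
have mR : 0 < m%:R :> R by rewrite ltr0n.
have [le_mn|lt_nm] := leqP m n.
(* Reversal puts the lowest score first, so that upper sets become suffixes; negation lets [true]
   mark the test scores. *)
- pose f A := rev (map negb (rank_word A)).
  have f_inj : injective f.
    by move=> A B /(can_inj revK)/(inj_map negb_inj)/rank_word_inj.
  have f_size A : size (f A) = N by rewrite size_rev size_map size_rank_word.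
  have PQ (A : {set 'I_N}) : (#|A| == n) && set_overshoots lam A ->
      (count id (f A) == m) && overshoots R n m lam (f A).
    case/andP=> /eqP cA /existsP[z hz]; apply/andP; split.
      have := count_predC id (rank_word A).
      rewrite size_rank_word count_rank_word cA => /addnI/eqP.
      by rewrite count_rev count_map (eq_count (a2 := predC id)).
    have [i iN /(_ A)[hA hAc]] := take_rank_word z.
    apply: (@overshoots_drop R n m lam _ (N - i)).
    rewrite /f drop_rev size_map size_rank_word subKn// !count_rev -map_take !count_map.
    rewrite (eq_count (a2 := id)); last by move=> b /=; rewrite negbK.
    by rewrite hA (eq_count (a2 := negb))// hAc.
  have := @card_set_words _
    (fun w => (count id w == m) && overshoots R n m lam w) f f_inj f_size PQ.
  rewrite -(ler_nat R) => /le_trans; apply.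
  have := @count_overshoots R n m lam m_gt0 le_mn lam0 lam1 mu N m (leq_addl _ _) mu0.
  rewrite -natrD => /(_ mu_le)/le_trans; apply.
  by rewrite addnK tilt_start// -bin_sub ?leq_addl// addnK natrM natrD.
- have PQ (A : {set 'I_N}) : (#|A| == n) && set_overshoots lam A ->
      (count id (rank_word A) == n) && overshoots R m n lam (rank_word A).
    case/andP=> /eqP cA /existsP[z hz]; apply/andP; split.
      by rewrite count_rank_word cA.
    have [i iN /(_ A)[hA hAc]] := take_rank_word z.
    (* The suffix is the complement of the upper set: it holds the fractions [1 - a / n] of the
       calibration and [1 - b / m] of the test scores, whose difference is again [b / m - a / n]. *)
    apply: (@overshoots_drop R m n lam _ i).
    have ct p : count p (rank_word A) =
        (count p (take i (rank_word A)) + count p (drop i (rank_word A)))%N.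
      by rewrite -count_cat cat_take_drop.
    have cn : count negb (rank_word A) = m.
      have := count_predC id (rank_word A).
      by rewrite size_rank_word count_rank_word cA => /addnI.
    have := ct id; have := ct negb; rewrite cn count_rank_word cA hA hAc.
    move=> /(congr1 (fun k => k%:R : R)) + /(congr1 (fun k => k%:R : R)).
    rewrite !natrD /ahead => em en.
    set c1 := (count id _)%:R in en *; set c2 := (count negb _)%:R in em *.
    have -> : c1 = n%:R - (#|A :&: upper_set z|)%:R by lra.
    have -> : c2 = m%:R - (#|~: A :&: upper_set z|)%:R by lra.
    by move: hz; lra.
  have := @card_set_words _
    (fun w => (count id w == n) && overshoots R m n lam w) _
    rank_word_inj size_rank_word PQ.
  rewrite -(ler_nat R) => /le_trans; apply.
  have := @count_overshoots R m n lam n_gt0 (ltnW lt_nm) lam0 lam1 mu N n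
    (leq_addr _ _) mu0.
  rewrite -natrD (addnC m n) => /(_ mu_le)/le_trans; apply.
  by rewrite addKn tilt_start// (mulnC n m) (addnC n m) natrM natrD.
Qed.

End sets.

(** * The empirical p-value distribution *)

(** The p-values and [Fhat] count classical sets; this passes to boolean predicates. *)
Lemma card_mkset (T : finType) (p : pred T) : #|[set j : T | p j]| = #|p|.
Proof. by apply: eq_card => j; apply/idP/idP; rewrite in_setE. Qed.

Section discretization.
Variables (R : realType) (n m : nat).
Notation N := (n + m)%N.
Implicit Types (x y : N.-tuple R) (t : R).

Definition calib_above x (i : 'I_m) : nat :=
  #|[pred j : 'I_n | tnth x (rshift n i) <= tnth x (lshift m j)]|.

Lemma conf_pvalueE x i : conf_pvalue x i = (calib_above x i).+1%:R / n.+1%:R.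
Proof. by rewrite /conf_pvalue card_mkset nat1r. Qed.

Lemma FhatE x t :
  Fhat x t = (#|[pred i : 'I_m | (calib_above x i).+1%:R <= n.+1%:R * t]|)%:R / m%:R.
Proof.
rewrite /Fhat card_mkset; congr (_%:R / _); apply: eq_card => i.
rewrite /in_mem/=.
by rewrite conf_pvalueE ler_pdivrMr ?ltr0n// mulrC.
Qed.

(** The value of [Fhat] at [k / n.+1]; the [1 +] in the p-value makes the comparison strict. *)
Definition Fgrid x (k : nat) : R :=
  (#|[pred i : 'I_m | (calib_above x i < k)%N]|)%:R / m%:R.

(** Both terms depend on [t] only through the floor of [n.+1 * t], which is the witness [k]. *)
Lemma Fhat_In_grid x t : 0 <= t -> t <= 1 -> exists2 k, (k <= n.+1)%N &
  Fhat x t - In_fun n t = Fgrid x k - k%:R / n.+1%:R.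
Proof.
move=> t0 t1; rewrite /In_fun.
have : 0 <= Num.floor (n.+1%:R * t) by rewrite floor_ge0 mulr_ge0.
case E : (Num.floor (n.+1%:R * t)) => [k|//] _.
exists k.
  have /le_trans := floor_le (n.+1%:R * t).
  move=> /(_ n.+1%:R); rewrite E -pmulrn ler_nat; apply.
  by rewrite ler_piMr.
congr (_ - _); rewrite FhatE /Fgrid; congr (_%:R / _); apply: eq_card => i.
by rewrite !inE -(lez_nat _ k) -E floor_ge_int.
Qed.

Lemma Fgrid_In_fun x k : (k <= n.+1)%N ->
  Fhat x (k%:R / n.+1%:R) - In_fun n (k%:R / n.+1%:R) =
  Fgrid x k - k%:R / n.+1%:R.
Proof.
move=> kn.
have E : n.+1%:R * (k%:R / n.+1%:R) = k%:R :> R by rewrite mulrC divfK ?pnatr_eq0.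
rewrite FhatE /In_fun /Fgrid E.
rewrite (_ : Num.floor k%:R = k%:Z) ?pmulrn ?intrKfloor//.
by congr (_%:R / _ - _); apply: eq_card => i; rewrite !inE ler_nat.
Qed.

Hypothesis m_gt0 : (0 < m)%N.

Lemma Fgrid_le1 x k : Fgrid x k <= 1.
Proof.
rewrite /Fgrid ler_pdivrMr ?ltr0n// mul1r ler_nat.
by rewrite (leq_trans (max_card _))// card_ord.
Qed.

(** Reduces the supremum to finitely many grid points. The point [t = 0] shows that the set is
    nonempty and 1 bounds it, so [sup] is a genuine supremum. *)
Lemma lt_sup_grid x (lam : R) :
  lam < sup [set Fhat x t - In_fun n t | t in `[0, 1]] <->
  exists2 k, (k <= n.+1)%N & lam < Fgrid x k - k%:R / n.+1%:R.
Proof.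
split=> [|[k kn hk]].
  case/sup_gt => [|_ [t /= + <-]].
    by exists (Fhat x 0 - In_fun n 0), 0 => //=; rewrite in_itv/= lexx ler01.
  rewrite in_itv/= => /andP[t0 t1]; have [k kn ->] := Fhat_In_grid x t t0 t1.
  by exists k.
apply: lt_le_trans hk _; apply: ub_le_sup; last first.
  exists (k%:R / n.+1%:R); last by rewrite /= Fgrid_In_fun.
  by rewrite /= in_itv/= divr_ge0//= ler_pdivrMr ?ltr0n// mul1r ler_nat.
exists 1 => _ [t /= + <-]; rewrite in_itv/= => /andP[t0 t1].
have [k' _ ->] := Fhat_In_grid x t t0 t1.
by rewrite lerBlDr (le_trans (Fgrid_le1 _ _))// lerDl divr_ge0.
Qed.

(* Among the test scores counted by [Fgrid x k], the lowest one witnesses the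
   excess: it has fewer than [k] calibration scores above it. *)
Lemma grid_witness x (lam : R) k : (0 < n)%N -> 0 < lam -> (k <= n.+1)%N ->
  lam < Fgrid x k - k%:R / n.+1%:R ->
  exists i0 : 'I_m, n%:R * m%:R * lam <
    n%:R * (#|[pred i : 'I_m | tnth x (rshift n i0) <= tnth x (rshift n i)]|)%:R
    - m%:R * (calib_above x i0)%:R.
Proof.
move=> n_gt0 lam0 kn hk.
have mR : 0 < m%:R :> R by rewrite ltr0n.
have nR : 0 < n%:R :> R by rewrite ltr0n.
pose Q := [pred i : 'I_m | (calib_above x i < k)%N].
have [i1 Qi1|Q0] := pickP Q; last first.
  move: hk; rewrite /Fgrid (eq_card0 Q0) mul0r sub0r ltNge => /negP[].
  by rewrite (@le_trans _ _ 0) ?(ltW lam0)// oppr_le0 divr_ge0.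
have [i0 Qi0 i0min] := arg_minP (fun i => tnth x (rshift n i)) Qi1.
exists i0; set b := #|_|.
have bQ : (#|Q| <= b)%N by apply: subset_leq_card; apply/fintype.subsetP => i /i0min.
have an : (calib_above x i0 <= n)%N by rewrite (leq_trans (max_card _))// card_ord.
(* Passage from denominator [n + 1] to [n]: with [a] the count, [a < k] and [a <= n] give
   [a (n + 1) <= (a + 1) n <= k n]. *)
have ak : (calib_above x i0)%:R / n%:R <= k%:R / n.+1%:R :> R.
  rewrite ler_pdivrMr// mulrAC ler_pdivlMr ?ltr0n// -!natrM ler_nat.
  apply: (@leq_trans ((calib_above x i0).+1 * n)).
    by rewrite mulnS mulSn leq_add2r.
  by rewrite leq_mul2r orbC (_ : _ < k)%N.
have : lam < b%:R / m%:R - (calib_above x i0)%:R / n%:R.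
  apply: (lt_le_trans hk); rewrite lerB// ler_pM2r ?invr_gt0// ler_nat.
  exact: bQ.
rewrite -(@ltr_pM2l _ (n%:R * m%:R)) ?mulr_gt0//.
by congr (_ < _); field; rewrite !gt_eqF.
Qed.

End discretization.

(** * Exchangeability *)

(** Listing [A] first and its complement next defines the permutation; it moves the calibration
    positions onto [A]. *)
Lemma perm_to_subset (N n : nat) (A : {set 'I_N}) : #|A| = n ->
  exists s : 'S_N, forall k, (s k \in A) = (k < n)%N.
Proof.
move=> cA; pose e := enum A ++ enum (~: A).
have size_e : size e = N by rewrite size_cat -!cardE cardsC card_ord.
have uniq_e : uniq e.
  rewrite cat_uniq !enum_uniq andbT /=; apply/hasPn => k.
  by rewrite !mem_enum inE.
have f_inj : injective (fun k : 'I_N => nth k e k).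
  move=> k l; rewrite (set_nth_default k) ?size_e// => /eqP.
  by rewrite nth_uniq ?size_e// => /eqP/val_inj.
exists (perm f_inj) => k; rewrite permE nth_cat -cardE cA.
case: ltnP => kn; first by rewrite -mem_enum mem_nth// -cardE cA.
have : nth k (enum (~: A)) (k - n) \in enum (~: A).
  rewrite mem_nth// -cardE; have := cardsC A; rewrite cA card_ord => eN.
  by rewrite ltn_subLR// eN.
by rewrite mem_enum inE => /negbTE.
Qed.

(** After permutation by [s] the calibration scores are those indexed by [A]. The image under [s] of
    the index from [grid_witness] defines the upper set, which holds at least as many test scores
    and at most as many calibration scores. *)
Lemma overshoots_permuted (R : realType) (n m : nat) (x : (n + m).-tuple R)
    (s : 'S_(n + m)) (A : {set 'I_(n + m)}) (lam : R) k :
  (0 < n)%N -> (0 < m)%N -> 0 < lam -> (forall l, (s l \in A) = (l < n)%N) ->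
  (k <= n.+1)%N -> lam < Fgrid R n m (permute_tuple s x) k - k%:R / n.+1%:R ->
  set_overshoots R n m (tnth x) lam A.
Proof.
move=> n0 m0 lam0 sA kn /grid_witness -/(_ m0 n0 lam0 kn)[i0 hi0].
have permE l : tnth (permute_tuple s x) l = tnth x (s l) by rewrite tnth_mktuple.
apply/existsP; exists (s (rshift n i0)); apply: lt_le_trans hi0 _.
rewrite lerB// ler_wpM2l// ler_nat.
- rewrite -(@card_imset _ _ (fun i => s (rshift n i))); last first.
    by move=> i j /perm_inj/rshift_inj.
  apply: subset_leq_card; apply/fintype.subsetP => _ /imsetP[i + ->].
  by rewrite !inE !permE sA /= -ltnNge ltnS leq_addr.
- rewrite /calib_above -(@card_imset _ _ (fun j => s (lshift m j))); last first.
    by move=> i j /perm_inj/lshift_inj.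
  apply: subset_leq_card; apply/fintype.subsetP => l.
  rewrite !inE -(permKV s l) sA => /andP[ln le_l].
  have el : (s^-1)%g l = lshift m (Ordinal ln) by exact: val_inj.
  by apply/imsetP; exists (Ordinal ln); rewrite ?inE ?permE -el// permKV.
Qed.

(** * Measurability of events determined by the order of the scores *)

Section comparison_pattern.
Variables (R : realType) (N : nat).

Definition comparisons (x : N.-tuple R) : {ffun 'I_N * 'I_N -> bool} :=
  [ffun ij => tnth x ij.1 <= tnth x ij.2].

(** There are finitely many comparison patterns, each cut out by finitely many measurable
    conditions. *)
Lemma measurable_comparisons (E : set (N.-tuple R)) :
  (forall x y, comparisons x = comparisons y -> E x -> E y) -> measurable E.
Proof.
move=> E_inv.
have -> : E = \bigcup_(M in [set M | exists2 x, E x & comparisons x = M])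
    \bigcap_(ij in [set: 'I_N * 'I_N])
      ((fun x : N.-tuple R => tnth x ij.1 <= tnth x ij.2) @^-1` [set M ij]).
  apply/seteqP; split=> [x Ex|x [M [y Ey <-] h]].
    by exists (comparisons x) => [|ij _ /=]; [exists x | rewrite ffunE].
  apply: E_inv Ey; apply/ffunP => ij; have := h ij I.
  by rewrite /= !ffunE => ->.
apply: fin_bigcup_measurable => [|M _]; first exact: finite_finset.
apply: fin_bigcap_measurable => [|ij _]; first exact: finite_finset.
rewrite -[X in measurable X]setTI.
by apply: measurable_fun_ler => //; exact: measurable_tnth.
Qed.

End comparison_pattern.

(** The sum is the expected number of events that occur, and this number is bounded for every
    outcome. *)
Lemma sum_probability_le d (T : measurableType d) (R : realType)
    (P : probability T R) (I : finType) (p : pred I) (F : I -> set T) (K : R) :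
  (forall i, measurable (F i)) ->
  (forall w, (#|[pred i | p i && (w \in F i)]|)%:R <= K) ->
  (\sum_(i | p i) P (F i) <= K%:E)%E.
Proof.
move=> mF FK.
apply: (@le_trans _ _ (\int[P]_w (\sum_(i <- enum p) (\1_(F i) w)%:E))%E).
  rewrite ge0_integral_sum//.
  - rewrite big_enum/= le_eqVlt; apply/orP; left; apply/eqP/eq_bigr => i _.
    by rewrite integral_indic// setIT.
  - by move=> i; apply/measurable_EFinP; exact: measurable_indic.
apply: (@le_trans _ _ (\int[P]_w (cst K%:E w))%E); last first.
  rewrite integral_cst// -[leRHS]mule1 le_eqVlt; apply/orP; left; apply/eqP.
  by congr (_ * _)%E; exact: probability_setT.
apply: ge0_le_integral => //.
- by move=> w _; apply: sume_ge0 => i _; rewrite lee_fin.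
- by apply: emeasurable_sum => i; apply/measurable_EFinP; exact: measurable_indic.
move=> w _ /=; rewrite sumEFin lee_fin; apply: le_trans (FK w).
rewrite big_enum/= -sum1_card natr_sum big_mkcondr/= le_eqVlt.
by apply/orP; left; apply/eqP/eq_bigr => i _; rewrite indicE; case: (w \in F i).
Qed.

Section conformal.
Variables (R : realType) (n m : nat).
Hypotheses (n_gt0 : (0 < n)%N) (m_gt0 : (0 < m)%N).
Notation N := (n + m)%N.

Definition grid_event (lam : R) : set (N.-tuple R) :=
  [set x | exists2 k, (k <= n.+1)%N & lam < Fgrid R n m x k - k%:R / n.+1%:R].

Lemma measurable_grid_event_permuted lam (s : 'S_N) :
  measurable [set x | grid_event lam (permute_tuple s x)].
Proof.
apply: measurable_comparisons => x y cxy [k kn h]; exists k => //.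
rewrite (_ : Fgrid R n m (permute_tuple s y) k = Fgrid R n m (permute_tuple s x) k)//.
congr (_%:R / _); apply: eq_card => i; rewrite !inE; congr (_ < k)%N.
apply: eq_card => j; rewrite !inE !tnth_mktuple.
by have /ffunP/(_ (s (rshift n i), s (lshift m j))) := cxy; rewrite !ffunE.
Qed.

(** Averaging over [A] replaces conditioning on the order statistics: by exchangeability each [F A]
    with [#|A| = n] is as likely as the event itself, and for every outcome [card_set_overshoots]
    bounds how many of them occur. *)
Lemma exchangeable_overshoot d (T : measurableType d) (P : probability T R)
    (X : T -> N.-tuple R) (lam mu : R) : exchangeable P X ->
  0 < lam -> lam <= 1 -> 0 <= mu -> mu = 0 \/ mu <= lam - 2 / (N%:R + 2) ->
  (P [set w | (lam < sup [set Fhat (X w) t - In_fun n t | t in `[0, 1]])%R]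
     <= (expR (- (2 * tau n m * lam * mu)))%:E)%E.
Proof.
move=> [mX exX] lam0 lam1 mu0 mu_le.
have -> : [set w | (lam < sup [set Fhat (X w) t - In_fun n t | t in `[0, 1]])%R] =
    X @^-1` grid_event lam.
  by apply/seteqP; split=> w /= /(lt_sup_grid R n m m_gt0).
have /boolp.choice[s sA] : forall A : {set 'I_N}, exists s : 'S_N,
    #|A| = n -> forall k, (s k \in A) = (k < n)%N.
  move=> A; have [cA|ncA] := eqVneq #|A| n; last first.
    (* The identity is a default value for sets of another cardinality. *)
    by exists 1%g => /eqP; rewrite (negbTE ncA).
  by have [s hs] := @perm_to_subset N n A cA; exists s.
pose F (A : {set 'I_N}) := (fun w => permute_tuple (s A) (X w)) @^-1` grid_event lam.
have mE : measurable (grid_event lam).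
  have := measurable_grid_event_permuted lam 1%g; congr measurable.
  apply/seteqP; split=> x; rewrite /= (_ : permute_tuple 1 x = x)//;
    by apply: eq_from_tnth => i; rewrite tnth_mktuple perm1.
have mF A : measurable (F A).
  rewrite /F -[X in measurable X]setTI.
  exact: (mX measurableT _ (measurable_grid_event_permuted lam (s A))).
have finE : P (X @^-1` grid_event lam) \is a fin_num.
  apply: fin_num_measure; rewrite -[X in measurable X]setTI.
  exact: (mX measurableT _ mE).
set K := 'C(N, n)%:R * expR (- (2 * tau n m * lam * mu)).
have : (\sum_(A : {set 'I_N} | #|A| == n) P (F A) <= K%:E)%E.
  apply: sum_probability_le => // w.
  have := @card_set_overshoots R n m (tnth (X w)) n_gt0 m_gt0 lam mu
    lam0 lam1 mu0 mu_le.
  apply: le_trans; rewrite ler_nat; apply: subset_leq_card.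
  apply/fintype.subsetP => A; rewrite !inE => /andP[cA]; rewrite cA /=.
  rewrite in_setE => -[k kn hk]; apply: overshoots_permuted hk => //.
  exact/sA/eqP.
have -> : (\sum_(A : {set 'I_N} | #|A| == n) P (F A) =
    ('C(N, n)%:R * fine (P (X @^-1` grid_event lam)))%:E)%E.
  rewrite (eq_bigr (fun=> (fine (P (X @^-1` grid_event lam)))%:E)); last first.
    by move=> A _; rewrite fineK// exX.
  have <- : #|finset (fun A : {set 'I_N} => #|A| == n)| = 'C(N, n).
    by rewrite card_draws card_ord.
  rewrite sumEFin mulr_natl -sumr_const.
  by congr EFin; apply: eq_bigl => A; rewrite inE.
by rewrite lee_fin /K ler_pM2l ?ltr0n ?bin_gt0 ?leq_addr// -lee_fin fineK.
Qed.

(** * The numerical bounds *)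

(** The fourth power of [expR (- 1 / 4) >= 3 / 4]. *)
Lemma expR1_le : expR 1 <= 256 / 81 :> R.
Proof.
have h := expR_ge1Dx (- (4^-1) : R).
have e0 := expR_gt0 (1 : R).
have : (3 / 4) ^+ 4 <= expR (- (4^-1) : R) ^+ 4.
  by rewrite lerXn2r ?nnegrE ?expR_ge0//; lra.
rewrite -expRM_natl (_ : 4%:R * - 4^-1 = -1) ?expRN; last by field.
rewrite -(ler_pM2r e0) mulVf ?gt_eqF//; lra.
Qed.

Lemma tau_gt0 : 0 < tau n m :> R.
Proof. by rewrite divr_gt0 ?ltr0n ?muln_gt0 ?addn_gt0 ?n_gt0. Qed.

Lemma tau_le : tau n m <= N%:R / 4 :> R.
Proof.
rewrite ler_pdivrMr ?ltr0n ?addn_gt0 ?n_gt0// mulrAC ler_pdivlMr// natrM natrD.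
by have := sqr_ge0 (n%:R - m%:R : R); lra.
Qed.

Lemma expR_le_B_DKW (lam mu : R) : 0 < lam -> lam < 1 -> mu <= lam ->
  lam - mu <= 2 / (N%:R + 2) ->
  expR (- (2 * tau n m * lam * mu)) <= B_DKW n m lam.
Proof.
move=> lam0 lam1 mu_le mu_ge; rewrite /B_DKW lam1 mul1r.
have t0 := tau_gt0; have t1 := tau_le.
have N0 : 0 < N%:R :> R by rewrite ltr0n addn_gt0 n_gt0.
have -> : - (2 * tau n m * lam * mu) =
    2 * tau n m * lam * (lam - mu) + - (2 * tau n m * lam ^+ 2) by ring.
rewrite expRD ler_pM2r ?expR_gt0//.
(* [v] bounds the exponent lost by using [mu] in place of [lam]. As [4 * tau <= N], it lies in
   [[0, 1]], where the chord of [expR] has slope [expR 1 - 1 <= 175 / 81]. *)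
pose v := 4 * tau n m * lam / (N%:R + 2).
have tl0 : 0 < tau n m * lam by rewrite mulr_gt0.
have v0 : 0 <= v by rewrite divr_ge0; lra.
have v1 : v <= 1.
  rewrite ler_pdivrMr ?mul1r; last by lra.
  apply: (@le_trans _ _ (4 * tau n m)); last by lra.
  by rewrite ler_piMr ?(ltW lam1)// mulr_ge0// ltW.
apply: (@le_trans _ _ (expR v)).
  rewrite ler_expR /v; apply: (@le_trans _ _ (2 * (tau n m * lam) * (2 / (N%:R + 2)))).
    by rewrite -[X in X * _]mulrA ler_pM2l// mulr_gt0.
  by rewrite le_eqVlt; apply/orP; left; apply/eqP; ring.
have := expR_scale_le R v 1 v0 v1; rewrite mulr1 => /le_trans; apply.
have e1 := expR1_le.
apply: (@le_trans _ _ (1 + v * (175 / 81))); first by nra.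
rewrite lerD2l /v.
set q := Num.sqrt N%:R; set c := Num.sqrt (2 * pi).
have q0 : 0 < q by rewrite sqrtr_gt0.
have c2 : 2 <= c.
  have -> : 2 = Num.sqrt (2 ^+ 2) :> R by rewrite sqrtr_sqr ger0_norm.
  rewrite ler_wsqrtr//; have := pi_ge2 R; lra.
have Nq : N%:R = q ^+ 2 by rewrite sqr_sqrtr// ltW.
have -> : 4 * tau n m * lam / (N%:R + 2) * (175 / 81) =
    2 * (tau n m * lam) * ((350 / 81) / (N%:R + 2)) by field; rewrite gt_eqF//; lra.
have -> : 2 * c * lam * tau n m / q = 2 * (tau n m * lam) * (c / q).
  by field; rewrite gt_eqF.
have tl2 : 0 < 2 * (tau n m * lam) by rewrite pmulr_rgt0.
rewrite (ler_pM2l tl2) ler_pdivrMr; last by lra.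
rewrite mulrAC ler_pdivlMr// Nq.
(* The quadratic [2 q^2 - (350 / 81) q + 4] has negative discriminant. *)
apply: (@le_trans _ _ (2 * (q ^+ 2 + 2))).
  have := sqr_ge0 (q - 1); nra.
by rewrite ler_wpM2r// addr_ge0// sqr_ge0.
Qed.

(** * The iteration defining the confidence radius *)

Section quantile.
Variables (delta : R).
Hypothesis delta01 : 0 < delta < 1.

Let slope : R := Num.sqrt (2 * pi) * (2 * tau n m) / Num.sqrt N%:R.

Let slope_ge0 : 0 <= slope.
Proof. by rewrite divr_ge0// mulr_ge0// mulr_ge0// ltW// tau_gt0. Qed.

Let PsiE x : Psi n m delta x = Order.min 1
  (Num.sqrt ((ln (1 / delta) + ln (1 + slope * x)) / (2 * tau n m))).
Proof.
by rewrite /Psi /slope; congr (Order.min _ (Num.sqrt ((_ + ln (1 + _)) / _))); ring.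
Qed.

Lemma Psi_mono x y : 0 <= x -> x <= y -> Psi n m delta x <= Psi n m delta y.
Proof.
move=> x0 xy; rewrite !PsiE le_min ge_min lexx/= ge_min; apply/orP; right.
rewrite ler_wsqrtr// ler_wpM2r ?invr_ge0 ?mulr_ge0 ?(ltW tau_gt0)// lerD2l.
have sx : 0 <= slope * x by rewrite mulr_ge0.
have sxy : slope * x <= slope * y by rewrite ler_wpM2l.
by rewrite ler_ln ?posrE; lra.
Qed.

Lemma lambda_DKW_ge0 r : 0 <= lambda_DKW n m delta r.
Proof. by case: r => [|r] //=; rewrite PsiE le_min ler01 sqrtr_ge0. Qed.

(** The first step is [Psi <= 1]; monotonicity of [Psi] propagates it. *)
Lemma lambda_DKW_decr r :
  lambda_DKW n m delta r.+1 <= lambda_DKW n m delta r.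
Proof.
elim: r => [|r IH]; first by rewrite /= PsiE ge_min lexx.
exact: Psi_mono (lambda_DKW_ge0 _) IH.
Qed.

(** If the last iterate [l] is below 1, the minimum in [Psi] is the square root, so the exponential
    equals [delta / (1 + slope * l')] with [l'] the previous iterate; [l <= l'] then bounds the
    prefactor by [1 + slope * l']. *)
Lemma B_DKW_lambda_DKW r : (1 <= r)%N -> B_DKW n m (lambda_DKW n m delta r) <= delta.
Proof.
case: r => // r _; have /andP[d0 d1] := delta01.
set l := lambda_DKW n m delta r.+1; rewrite /B_DKW.
case: ltP => [l1|_]; last by rewrite !mul0r ltW.
rewrite mul1r; have t0 := tau_gt0.
set l' := lambda_DKW n m delta r.
have l'0 : 0 <= l' := lambda_DKW_ge0 r.
have l0 : 0 <= l := lambda_DKW_ge0 r.+1.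
have ll' : l <= l' := lambda_DKW_decr r.
have s'0 : 0 <= slope * l' by rewrite mulr_ge0.
have sll' : slope * l <= slope * l' by rewrite ler_wpM2l.
have lE : 2 * tau n m * l ^+ 2 = ln (1 / delta) + ln (1 + slope * l').
  have : l = Psi n m delta l' by [].
  rewrite PsiE; set z := Num.sqrt _ => lz.
  have {}lz : l = z by move: lz l1; rewrite minEle; case: ifP => // _ ->; rewrite ltxx.
  rewrite lz sqr_sqrtr; first by field; rewrite gt_eqF.
  rewrite divr_ge0 ?mulr_ge0 ?(ltW t0)// addr_ge0// ln_ge0//; last by lra.
  by rewrite ler_pdivlMr// mul1r ltW.
have di0 : 0 < 1 / delta by rewrite divr_gt0.
have sl0 : 0 < 1 + slope * l' by lra.
have dsl0 : 0 < 1 / delta * (1 + slope * l') by rewrite mulr_gt0.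
rewrite lE -lnM// expRN lnK//.
have -> : 1 + 2 * Num.sqrt (2 * pi) * l * tau n m / Num.sqrt N%:R = 1 + slope * l.
  by rewrite /slope; congr (1 + _); ring.
rewrite ler_pdivrMr// mulrA mul1r mulfV ?gt_eqF// mul1r; lra.
Qed.

End quantile.
End conformal.

Theorem theorem1 (n m : nat) (hn : (0 < n)%N) (hm : (0 < m)%N)
  (d : measure_display) (T : measurableType d) (R : realType)
  (P : probability T R) (X : T -> (n + m).-tuple R) :
  exchangeable P X -> as_no_ties P X ->
  (forall lam : R, 0 < lam ->
     (P [set w | (lam < sup [set Fhat (X w) t - In_fun n t | t in `[0, 1]])%R]
        <= (B_DKW n m lam)%:E)%E) /\
  (forall (delta : R), 0 < delta < 1 -> forall r : nat, (1 <= r)%N ->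
     B_DKW n m (lambda_DKW n m delta r) <= delta).
Proof.
move=> exX _; split=> [lam lam0|delta d01 r r1]; last exact: B_DKW_lambda_DKW.
have [lam1|lam1] := ltP lam 1; last first.
  (* For [lam >= 1] both sides vanish: [Fgrid] is at most 1, and the indicator in [B_DKW] is 0. *)
  rewrite (_ : [set w | _] = set0); last first.
    apply/seteqP; split=> // w /= /(lt_sup_grid _ _ _ hm)[k _].
    rewrite ltNge (le_trans _ lam1)// lerBlDr (le_trans (Fgrid_le1 _ _ _ hm _ _))//.
    by rewrite lerDl divr_ge0.
  by rewrite measure0 lee_fin /B_DKW ltNge lam1 !mul0r.
(* For small [lam] the truncation gives [mu = 0] and the exponential bound 1; in both cases
   [lam - mu] is at most [2 / (n + m + 2)]. *)
pose mu := Order.max 0 (lam - 2 / ((n + m)%:R + 2)).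
have N2 : 0 < 2 / ((n + m)%:R + 2) :> R by rewrite divr_gt0// ltr_wpDl.
have mu0 : 0 <= mu by rewrite le_max lexx.
have mu_cases : mu = 0 \/ mu <= lam - 2 / ((n + m)%:R + 2).
  by rewrite /mu maxEle; case: ifP => _; [right | left].
apply: (le_trans (exchangeable_overshoot _ _ _ hn hm _ _ _ _ _ _
  exX lam0 (ltW lam1) mu0 mu_cases)).
rewrite lee_fin expR_le_B_DKW//.
  by rewrite ge_max (ltW lam0)/= gerBl ltW.
by rewrite lerBlDl -lerBlDr le_max lexx orbT.
Qed.
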